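(* (i) $\langle \mathsf{BiLat}, -, \partial\rangle$ is the clone of all De Morgan functions. (ii) $\langle \mathsf{BiLat}, \partial\rangle$ is the clone of all positive De Morgan functions. (iii) $\langle \mathsf{BiLat}, -\rangle$ is the clone of all persistent De Morgan functions.
   Context: Let $\mathrm{DM}_4=\{\mathsf t,\mathsf f,\mathsf n,\mathsf b\}$. The truth order $\le$ has $\mathsf f$ least, $\mathsf t$ greatest, $\mathsf n,\mathsf b$ incomparable; $\wedge,\vee$ are its meet and join. The information order $\sqsubseteq$ has $\mathsf n$ least, $\mathsf b$ greatest, $\mathsf t,\mathsf f$ incomparable; $\otimes,\oplus$ are its meet and join. De Morgan negation: $-\mathsf t=\mathsf f$, $-\mathsf f=\mathsf t$, $-\mathsf n=\mathsf n$, $-\mathsf b=\mathsf b$. Conflation: $\partial\mathsf t=\mathsf t$, $\partial\mathsf f=\mathsf f$, $\partial\mathsf n=\mathsf b$, $\partial\mathsf b=\mathsf n$. A De Morgan function is a map $\mathrm{DM}_4^n\to\mathrm{DM}_4$, $n\ge1$; a clone is a set of such functions closed under composition and containing all projections; constants are treated as unary constant functions. $\langle\mathsf C,f_1,\dots\rangle$ is the clone generated by $\mathsf C\cup\{f_1,\dots\}$. $\mathsf{BiLat}=\langle\wedge,\vee,\mathsf t,\mathsf f,\otimes,\oplus,\mathsf b,\mathsf n\rangle$. Orders on tuples are componentwise; $f$ is positive if $\overline a\le\overline b\Rightarrow f(\overline a)\le f(\overline b)$ and persistent if $\overline a\sqsubseteq\overline b\Rightarrow f(\overline a)\sqsubseteq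 f(\overline b)$. *)

(* Defs.v *)
From HB Require Import structures.
From mathcomp Require Import all_boot all_order.
From mathcomp Require Import classical_sets.

Set Implicit Arguments.
Unset Strict Implicit.
Unset Printing Implicit Defensive.

Local Open Scope classical_set_scope.

Inductive dm4 : Type := DMt | DMf | DMn | DMb.

Definition bool2_of_dm4 (x : dm4) : bool * bool :=
  match x with
  | DMt => (true, false)
  | DMf => (false, true)
  | DMn => (false, false)
  | DMb => (true, true)
  end.

Definition dm4_of_bool2 (p : bool * bool) : dm4 :=
  match p with
  | (true, false) => DMt
  | (false, true) => DMf
  | (false, false) => DMn
  | (true, true) => DMb
  end.

Lemma bool2_of_dm4K : cancel bool2_of_dm4 dm4_of_bool2.
Proof. by case. Qed.

HB.instance Definition _ := Finite.copy dm4 (can_type bool2_of_dm4K).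

(* [dm4] itself carries the truth order; the information order is put on the
   convertible alias [dm4i]. *)
Definition dm4i : Type := dm4.

HB.instance Definition _ := Finite.on dm4i.

Definition truth_le (x y : dm4) : bool := [|| x == y, x == DMf | y == DMt].

Definition info_le (x y : dm4i) : bool := [|| x == y, x == DMn | y == DMb].

Definition truth_meet (x y : dm4) : dm4 :=
  match x, y with
  | DMt, z | z, DMt => z
  | DMn, DMn => DMn
  | DMb, DMb => DMb
  | _, _ => DMf
  end.

Definition truth_join (x y : dm4) : dm4 :=
  match x, y with
  | DMf, z | z, DMf => z
  | DMn, DMn => DMn
  | DMb, DMb => DMb
  | _, _ => DMt
  end.

Definition info_meet (x y : dm4i) : dm4i :=
  match x, y with
  | DMb, z | z, DMb => z
  | DMt, DMt => DMt
  | DMf, DMf => DMf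
  | _, _ => DMn
  end.

Definition info_join (x y : dm4i) : dm4i :=
  match x, y with
  | DMn, z | z, DMn => z
  | DMt, DMt => DMt
  | DMf, DMf => DMf
  | _, _ => DMb
  end.

Fact truth_display : Order.disp_t. Proof. exact: Order.Disp tt tt. Qed.
Fact info_display : Order.disp_t. Proof. exact: Order.Disp tt tt. Qed.

Lemma truth_le_refl : reflexive truth_le. Proof. by case. Qed.
Lemma truth_le_anti : antisymmetric truth_le. Proof. by do 2 case. Qed.
Lemma truth_le_trans : transitive truth_le. Proof. by do 3 case. Qed.

HB.instance Definition _ := Order.Le_isPOrder.Build truth_display dm4
  truth_le_refl truth_le_anti truth_le_trans.

Lemma truth_meetP (x y z : dm4) :
  (x <= truth_meet y z)%O = (x <= y)%O && (x <= z)%O.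
Proof. by case: x y z => - [] []. Qed.
Lemma truth_joinP (x y z : dm4) :
  (truth_join x y <= z)%O = (x <= z)%O && (y <= z)%O.
Proof. by case: x y z => - [] []. Qed.

HB.instance Definition _ :=
  @Order.POrder_MeetJoin_isLattice.Build truth_display dm4
    truth_meet truth_join truth_meetP truth_joinP.

Lemma info_le_refl : reflexive info_le. Proof. by case. Qed.
Lemma info_le_anti : antisymmetric info_le. Proof. by do 2 case. Qed.
Lemma info_le_trans : transitive info_le. Proof. by do 3 case. Qed.

HB.instance Definition _ := Order.Le_isPOrder.Build info_display dm4i
  info_le_refl info_le_anti info_le_trans.

Lemma info_meetP (x y z : dm4i) :
  (x <= info_meet y z)%O = (x <= y)%O && (x <= z)%O.
Proof. by case: x y z => - [] []. Qed.
Lemma info_joinP (x y z : dm4i) :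
  (info_join x y <= z)%O = (x <= z)%O && (y <= z)%O.
Proof. by case: x y z => - [] []. Qed.

HB.instance Definition _ :=
  @Order.POrder_MeetJoin_isLattice.Build info_display dm4i
    info_meet info_join info_meetP info_joinP.

Definition neg4 (x : dm4) : dm4 :=
  match x with DMt => DMf | DMf => DMt | DMn => DMn | DMb => DMb end.

Definition conf4 (x : dm4) : dm4 :=
  match x with DMt => DMt | DMf => DMf | DMn => DMb | DMb => DMn end.

Definition dmop (n : nat) := {ffun n.-tuple dm4 -> dm4}.

(* The tag is the predecessor of the arity, so that arities are >= 1. *)
Definition dmfun := {n : nat & dmop n.+1}.

Definition mkdmfun (n : nat) (f : dmop n.+1) : dmfun := existT _ n f.

Definition dmproj (n : nat) (i : 'I_n) : dmop n := [ffun a => tnth a i].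

Definition dmcomp (m n : nat) (f : dmop m) (g : 'I_m -> dmop n) : dmop n :=
  [ffun a => f [tuple g i a | i < m]].

Definition is_clone (C : set dmfun) : Prop :=
  (forall (n : nat) (i : 'I_n.+1), C (mkdmfun (dmproj i))) /\
  (forall (m n : nat) (f : dmop m.+1) (g : 'I_m.+1 -> dmop n.+1),
     C (mkdmfun f) -> (forall i, C (mkdmfun (g i))) ->
     C (mkdmfun (dmcomp f g))).

Definition clone_gen (F : set dmfun) : set dmfun := smallest is_clone F.

Definition dm_const (c : dm4) : dmfun :=
  @mkdmfun 0 [ffun _ : 1.-tuple dm4 => c].
Definition dm_unary (u : dm4 -> dm4) : dmfun :=
  @mkdmfun 0 [ffun a : 1.-tuple dm4 => u (tnth a ord0)].
Definition dm_binary (o : dm4 -> dm4 -> dm4) : dmfun :=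
  @mkdmfun 1 [ffun a : 2.-tuple dm4 => o (tnth a ord0) (tnth a ord_max)].

Definition dm_and : dmfun := dm_binary (fun x y : dm4 => Order.meet x y).
Definition dm_or : dmfun := dm_binary (fun x y : dm4 => Order.join x y).
Definition dm_otimes : dmfun := dm_binary (fun x y : dm4i => Order.meet x y).
Definition dm_oplus : dmfun := dm_binary (fun x y : dm4i => Order.join x y).
Definition dm_neg : dmfun := dm_unary neg4.
Definition dm_conf : dmfun := dm_unary conf4.

Definition BiLat : set dmfun :=
  clone_gen [set` [:: dm_and; dm_or; dm_const DMt; dm_const DMf;
                      dm_otimes; dm_oplus; dm_const DMb; dm_const DMn]].

Definition positive (f : dmfun) : Prop :=
  forall a b : (tag f).+1.-tuple dm4,
    (forall i, (tnth a i <= tnth b i)%O) ->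
    (tagged f a <= tagged f b)%O.

Definition persistent (f : dmfun) : Prop :=
  forall a b : (tag f).+1.-tuple dm4,
    (forall i, ((tnth a i : dm4i) <= (tnth b i : dm4i))%O) ->
    ((tagged f a : dm4i) <= (tagged f b : dm4i))%O.

(* Main.v *)
(** Identify dm4 with pairs (x1, x2) of Booleans, where t = (1, 0) and
    f = (0, 1). In each case, a function F respecting a reflexive relation R
    (equality, the truth order, the information order) is the join over all
    tuples a of F(a) meet chi_a, where chi_a(x) is top if R a_i x_i for all i
    and bottom otherwise; chi_a is a meet of unary indicators. These indicators
    are definable: for y = (x1, 0) and y = (1, x2), the term y /\ conf y is the
    truth value of x1 and of ~ x2, and negating these yields the indicators for
    equality; for y = (x1, 1) and y = (1, x2), the information meet of y and
    neg y is (x1, x1) and (x2, x2). *)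

Require Import Defs.
From HB Require Import structures.
From mathcomp Require Import all_boot all_order.
From mathcomp Require Import classical_sets.
Import Order.TTheory.

Set Implicit Arguments.
Unset Strict Implicit.
Unset Printing Implicit Defensive.

Local Open Scope classical_set_scope.

(** * Bounded lattices and joins of indicators *)

Lemma truth_le0x (x : dm4) : (DMf <= x)%O. Proof. by case: x. Qed.
Lemma truth_lex1 (x : dm4) : (x <= DMt)%O. Proof. by case: x. Qed.
HB.instance Definition _ := Order.hasBottom.Build truth_display dm4 truth_le0x.
HB.instance Definition _ := Order.hasTop.Build truth_display dm4 truth_lex1.

Lemma info_le0x (x : dm4i) : ((DMn : dm4i) <= x)%O. Proof. by case: x. Qed.
Lemma info_lex1 (x : dm4i) : (x <= (DMb : dm4i))%O. Proof. by case: x. Qed.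
HB.instance Definition _ := Order.hasBottom.Build info_display dm4i info_le0x.
HB.instance Definition _ := Order.hasTop.Build info_display dm4i info_lex1.

(** Reflexivity makes the term at [a = x] equal to [f x]; any other term is bottom or, by
    monotonicity, below [f x]. *)
Lemma join_indicators (d : Order.disp_t) (L : tbLatticeType d) (A : finType)
    (R : rel A) (f : A -> L) :
    reflexive R -> (forall a x, R a x -> (f a <= f x)%O) ->
  forall x, f x = (\join_a (f a `&` if R a x then \top else \bot))%O.
Proof.
move=> Rxx fR x; apply/le_anti/andP; split.
  by apply: (@joins_min _ _ _ x) => //; rewrite Rxx meetx1.
apply/joinsP => a _; case: ifP => [/fR|_]; first by rewrite meetx1.
by rewrite meetx0 le0x.
Qed.

Lemma meet_indicators (d : Order.disp_t) (L : tbLatticeType d) (I : finType)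
    (p : pred I) :
  (\meet_i (if p i then \top else \bot) =
   if [forall i, p i] then \top else \bot :> L)%O.
Proof.
case: ifPn => [/forallP pT|]; first by rewrite big1 // => i _; rewrite pT.
rewrite negb_forall => /existsP[i /negbTE pi].
apply/le_anti; rewrite le0x andbT.
by apply: (@meets_max _ _ _ i) => //; rewrite pi.
Qed.

Lemma clone_gen_is_clone (F : set dmfun) : is_clone (clone_gen F).
Proof.
split=> [n i|m n f g Cf Cg] C CF; first exact: CF.1.1.
by apply: CF.1.2 => [|i]; [apply: Cf | apply: Cg].
Qed.

(** * Closure of a clone under pointwise operations *)

Section CloneClosure.
Context {C : set dmfun} (cloneC : is_clone C).

(** Stated for plain functions, so that terms can be built pointwise and compared up to [=1] instead
    of through [dmcomp]. *)
Definition definable (n : nat) (h : n.+1.-tuple dm4 -> dm4) : Prop :=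
  C (mkdmfun [ffun a => h a]).

Lemma eq_definable n (h k : n.+1.-tuple dm4 -> dm4) :
  h =1 k -> definable h -> definable k.
Proof.
rewrite /definable => hk; congr (C (mkdmfun _)).
by apply/ffunP => a; rewrite !ffunE.
Qed.

Lemma definable_dmop n (f : dmop n.+1) : definable f -> C (mkdmfun f).
Proof.
by rewrite /definable; congr (C (mkdmfun _)); apply/ffunP => a; rewrite ffunE.
Qed.

Lemma definable_proj n (i : 'I_n.+1) : definable (fun a => tnth a i).
Proof. exact: cloneC.1. Qed.

Lemma definable_comp m n (f : dmop m.+1)
    (h : 'I_m.+1 -> n.+1.-tuple dm4 -> dm4) :
    C (mkdmfun f) -> (forall i, definable (h i)) ->
  definable (fun a => f [tuple h i a | i < m.+1]).
Proof.
move=> Cf Ch; have := cloneC.2 _ _ _ _ Cf Ch.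
congr (C (mkdmfun _)); apply/ffunP => a; rewrite !ffunE.
by congr (f _); apply: eq_from_tnth => i; rewrite !tnth_mktuple ffunE.
Qed.

Lemma definable_const c : C (dm_const c) ->
  forall n, definable (fun _ : n.+1.-tuple dm4 => c).
Proof.
(* A constant is unary, so it reaches other arities by composition with a projection; the first one
   exists in every arity [n.+1]. *)
move=> Cc n; have := definable_comp Cc (fun=> definable_proj (@ord0 n)).
by apply: eq_definable => a; rewrite ffunE.
Qed.

Lemma definable_unary u n (h : n.+1.-tuple dm4 -> dm4) :
  C (dm_unary u) -> definable h -> definable (fun a => u (h a)).
Proof.
move=> Cu Ch; have := definable_comp Cu (fun=> Ch).
by apply: eq_definable => a; rewrite ffunE tnth_mktuple.
Qed.

Lemma definable_binary o n (h k : n.+1.-tuple dm4 -> dm4) :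
    C (dm_binary o) -> definable h -> definable k ->
  definable (fun a => o (h a) (k a)).
Proof.
move=> Co Ch Ck.
have /(definable_comp Co) :
    forall i : 'I_2, definable (if i == ord0 then h else k).
  by move=> i; case: ifP.
by apply: eq_definable => a; rewrite ffunE !tnth_mktuple.
Qed.

Lemma definable_big o idx n (I : Type) (r : seq I)
    (h : I -> n.+1.-tuple dm4 -> dm4) :
    C (dm_binary o) -> C (dm_const idx) -> (forall i, definable (h i)) ->
  definable (fun a => \big[o/idx]_(i <- r) h i a).
Proof.
move=> Co Cidx Ch; elim: r => [|i r IHr].
  by apply: eq_definable (definable_const Cidx n) => a; rewrite big_nil.
apply: eq_definable (definable_binary Co (Ch i) IHr) => a.
by rewrite big_cons.
Qed.

(* The lattice structure on dm4 is a parameter because the lemma is used both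
   for the truth order and for the information order. *)
Lemma definable_from_indicators (d : Order.disp_t) (L : Order.TBLattice d dm4)
    (T := Order.TBLattice.Pack L) (R : rel dm4) n (f : dmop n.+1) :
    (forall c, C (dm_const c)) ->
    C (dm_binary (@Order.join d T)) -> C (dm_binary (@Order.meet d T)) ->
    (forall c, C (dm_unary (fun x =>
       if R c x then @Order.top d T else @Order.bottom d T))) ->
    reflexive R ->
    (forall a b : n.+1.-tuple dm4, (forall i, R (tnth a i) (tnth b i)) ->
      ((f a : T) <= (f b : T))%O) ->
  C (mkdmfun f).
Proof.
move=> Cc Cj Cm Cchi Rxx fR; apply: definable_dmop.
pose Rn (a b : n.+1.-tuple dm4) := [forall i, R (tnth a i) (tnth b i)].
have fE := @join_indicators d T _ Rn f.
apply: (@eq_definable _ (fun x => \big[@Order.join d T/@Order.bottom d T]_a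
   @Order.meet d T (f a) (\big[@Order.meet d T/@Order.top d T]_i
     if R (tnth a i) (tnth x i) then @Order.top d T else @Order.bottom d T))).
  move=> x; rewrite [RHS]fE.
  - by apply: eq_bigr => a _; rewrite meet_indicators.
  - by move=> a; apply/forallP.
  - by move=> a b /forallP/fR.
(* For a fixed tuple [a], the factor [f a] is a constant. *)
apply: definable_big => // a; apply: definable_binary => //.
  exact: definable_const.
apply: definable_big => // i.
exact: definable_unary (Cchi (tnth a i)) (definable_proj i).
Qed.

End CloneClosure.

(** * Functions preserving a binary relation *)

Section Preservation.
Variable R : rel dm4.

(** The polymorphisms of [R]: convertible to [positive] for [truth_le] and to [persistent] for
    [info_le]. *)
Definition preserving : set dmfun := [set f : dmfun |
  forall a b : (tag f).+1.-tuple dm4,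
    (forall i, R (tnth a i) (tnth b i)) -> R (tagged f a) (tagged f b)].

Lemma preserving_is_clone : is_clone preserving.
Proof.
split=> [n i a b Rab|m n f g Rf Rg a b Rab] /=; rewrite !ffunE //.
by apply: Rf => i; rewrite !tnth_mktuple; apply: Rg.
Qed.

Lemma preserving_const c : R c c -> preserving (dm_const c).
Proof. by move=> Rcc a b _; rewrite /= !ffunE. Qed.

Lemma preserving_unary u :
  (forall x y, R x y -> R (u x) (u y)) -> preserving (dm_unary u).
Proof. by move=> Ru a b Rab; rewrite /= !ffunE; apply: Ru. Qed.

Lemma preserving_binary o :
    (forall x y z t, R x y -> R z t -> R (o x z) (o y t)) ->
  preserving (dm_binary o).
Proof. by move=> Ro a b Rab; rewrite /= !ffunE; apply: Ro. Qed.

End Preservation.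

(** * Unary indicators in clones above [BiLat] *)

Section BiLatClone.
Context {C : set dmfun} (cloneC : is_clone C) (BiLatC : BiLat `<=` C).

Lemma BiLat_generator f :
    f \in [:: dm_and; dm_or; dm_const DMt; dm_const DMf;
              dm_otimes; dm_oplus; dm_const DMb; dm_const DMn] ->
  C f.
Proof. by move=> Gf; apply: BiLatC; apply: sub_gen_smallest. Qed.

Lemma BiLat_const c : C (dm_const c).
Proof.
by apply: BiLat_generator; case: c; rewrite !in_cons eqxx ?orbT.
Qed.

Lemma BiLat_truth_meet : C (dm_binary truth_meet).
Proof. by apply: BiLat_generator; rewrite !in_cons eqxx ?orbT. Qed.

Lemma BiLat_truth_join : C (dm_binary truth_join).
Proof. by apply: BiLat_generator; rewrite !in_cons eqxx ?orbT. Qed.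

Lemma BiLat_info_meet : C (dm_binary info_meet).
Proof. by apply: BiLat_generator; rewrite !in_cons eqxx ?orbT. Qed.

Lemma BiLat_info_join : C (dm_binary info_join).
Proof. by apply: BiLat_generator; rewrite !in_cons eqxx ?orbT. Qed.

Lemma dm_id_in_clone : C (dm_unary id).
Proof. exact: definable_proj. Qed.

Lemma dm_const_unary_in_clone c : C (dm_unary (fun=> c)).
Proof. exact/definable_const/BiLat_const. Qed.

Lemma dm_comp_in_clone u v :
  C (dm_unary u) -> C (dm_unary v) -> C (dm_unary (fun x => u (v x))).
Proof. exact: definable_unary. Qed.

Lemma dm_comp2_in_clone o u v :
    C (dm_binary o) -> C (dm_unary u) -> C (dm_unary v) ->
  C (dm_unary (fun x => o (u x) (v x))).
Proof. exact: definable_binary. Qed.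

Lemma eq_dm_unary_in_clone u v : u =1 v -> C (dm_unary u) -> C (dm_unary v).
Proof. by move=> uv; apply: eq_definable => a; apply: uv. Qed.

Lemma truth_indicator_coord1 :
  C dm_conf -> C (dm_unary (fun x => if truth_le DMb x then DMt else DMf)).
Proof.
(* [truth_le DMb x] means x1 = 1. As conflation sends (x1, x2) to (~ x2, ~ x1), the truth meet of
   [y x] = (x1, 0) and (1, ~ x1) is (x1, ~ x1). *)
move=> Cconf; pose y x := info_meet x DMt.
have Cy : C (dm_unary y).
  exact: dm_comp2_in_clone BiLat_info_meet dm_id_in_clone
    (dm_const_unary_in_clone _).
apply: eq_dm_unary_in_clone
  (dm_comp2_in_clone BiLat_truth_meet Cy (dm_comp_in_clone Cconf Cy)).
by case.
Qed.

Lemma truth_indicator_coord2 :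
  C dm_conf -> C (dm_unary (fun x => if truth_le DMn x then DMt else DMf)).
Proof.
(* [truth_le DMn x] means x2 = 0. Here [y x] = (1, x2) has conflation (~ x2, 0), and their truth
   meet is (~ x2, x2). *)
move=> Cconf; pose y x := info_join x DMt.
have Cy : C (dm_unary y).
  exact: dm_comp2_in_clone BiLat_info_join dm_id_in_clone
    (dm_const_unary_in_clone _).
apply: eq_dm_unary_in_clone
  (dm_comp2_in_clone BiLat_truth_meet Cy (dm_comp_in_clone Cconf Cy)).
by case.
Qed.

Lemma truth_indicator c :
  C dm_conf -> C (dm_unary (fun x => if truth_le c x then DMt else DMf)).
Proof.
move=> Cconf.
have Cb := truth_indicator_coord1 Cconf.
have Cn := truth_indicator_coord2 Cconf.
(* Only t lies above both b and n, and everything lies above f. *)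
case: c => //.
  apply: eq_dm_unary_in_clone (dm_comp2_in_clone BiLat_truth_meet Cb Cn).
  by case.
by apply: eq_dm_unary_in_clone (dm_const_unary_in_clone DMt); case.
Qed.

Lemma eq_indicator c :
    C dm_neg -> C dm_conf ->
  C (dm_unary (fun x => if c == x then DMt else DMf)).
Proof.
move=> Cneg Cconf.
have Cb := truth_indicator_coord1 Cconf.
have Cn := truth_indicator_coord2 Cconf.
have CNb := dm_comp_in_clone Cneg Cb; have CNn := dm_comp_in_clone Cneg Cn.
have Cm := BiLat_truth_meet.
(* On t and f, [neg4] is Boolean negation, so both coordinates can be tested for 0 and for 1; the
   two tests single out one element. *)
case: c.
- by apply: eq_dm_unary_in_clone (dm_comp2_in_clone Cm Cb Cn); case.
- by apply: eq_dm_unary_in_clone (dm_comp2_in_clone Cm CNb CNn); case.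
- by apply: eq_dm_unary_in_clone (dm_comp2_in_clone Cm CNb Cn); case.
- by apply: eq_dm_unary_in_clone (dm_comp2_in_clone Cm Cb CNn); case.
Qed.

Lemma info_indicator c :
  C dm_neg -> C (dm_unary (fun x => if info_le c x then DMb else DMn)).
Proof.
move=> Cneg.
have Cim := BiLat_info_meet.
(* Since b = (1, 1), truth meet and join with b give (x1, 1) and (1, x2); negation swaps the
   coordinates. *)
have Cand : C (dm_unary (fun x => truth_meet x DMb)).
  exact: dm_comp2_in_clone BiLat_truth_meet dm_id_in_clone
    (dm_const_unary_in_clone _).
have Cor : C (dm_unary (fun x => truth_join x DMb)).
  exact: dm_comp2_in_clone BiLat_truth_join dm_id_in_clone
    (dm_const_unary_in_clone _).
have Ct : C (dm_unary (fun x => if info_le DMt x then DMb else DMn)).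
  apply: eq_dm_unary_in_clone
    (dm_comp2_in_clone Cim Cand (dm_comp_in_clone Cneg Cand)).
  by case.
have Cf : C (dm_unary (fun x => if info_le DMf x then DMb else DMn)).
  apply: eq_dm_unary_in_clone
    (dm_comp2_in_clone Cim Cor (dm_comp_in_clone Cneg Cor)).
  by case.
case: c => //.
  by apply: eq_dm_unary_in_clone (dm_const_unary_in_clone DMb); case.
by apply: eq_dm_unary_in_clone (dm_comp2_in_clone Cim Ct Cf); case.
Qed.

(** * Functions respecting each relation lie in the clone *)

Lemma all_in_clone f : C dm_neg -> C dm_conf -> C f.
Proof.
case: f => n f Cneg Cconf.
apply: (@definable_from_indicators _ cloneC _
  (Order.TBLattice.class dm4) (fun x y => x == y)) => //.
- exact: BiLat_const.
- exact: BiLat_truth_join.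
- exact: BiLat_truth_meet.
- by move=> c; apply: eq_indicator.
- by move=> a b ab; rewrite (_ : a = b) //; apply/eq_from_tnth => i; apply/eqP.
Qed.

Lemma positive_in_clone f : C dm_conf -> positive f -> C f.
Proof.
case: f => n f Cconf fpos.
apply: (@definable_from_indicators _ cloneC _
  (Order.TBLattice.class dm4) truth_le) => //.
- exact: BiLat_const.
- exact: BiLat_truth_join.
- exact: BiLat_truth_meet.
- by move=> c; apply: truth_indicator.
Qed.

Lemma persistent_in_clone f : C dm_neg -> persistent f -> C f.
Proof.
case: f => n f Cneg fpers.
apply: (@definable_from_indicators _ cloneC _
  (Order.TBLattice.class dm4i) info_le) => //.
- exact: BiLat_const.
- exact: BiLat_info_join.
- exact: BiLat_info_meet.
- by move=> c; apply: info_indicator.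
- exact: info_le_refl.
Qed.

End BiLatClone.

(** * Preservation by the generators, and the three equalities *)

Lemma BiLat_positive : BiLat `<=` preserving truth_le.
Proof.
apply: smallest_sub; first exact: preserving_is_clone.
move=> f /=; rewrite !in_cons in_nil orbF.
do ?case/orP; move/eqP->;
  solve [ by apply: preserving_const; apply: truth_le_refl
        | by apply: preserving_binary; do 4!case ].
Qed.

Lemma BiLat_persistent : BiLat `<=` preserving info_le.
Proof.
apply: smallest_sub; first exact: preserving_is_clone.
move=> f /=; rewrite !in_cons in_nil orbF.
do ?case/orP; move/eqP->;
  solve [ by apply: preserving_const; apply: info_le_refl
        | by apply: preserving_binary; do 4!case ].
Qed.

Theorem mainTheorem3 :
  [/\ clone_gen (BiLat `|` [set dm_neg; dm_conf]) = [set: dmfun],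
      clone_gen (BiLat `|` [set dm_conf]) = [set f | positive f]
    & clone_gen (BiLat `|` [set dm_neg]) = [set f | persistent f]].
Proof.
have genBiLat F : BiLat `<=` clone_gen (BiLat `|` F).
  by move=> f Bf; apply: sub_gen_smallest; left.
have genF F : F `<=` clone_gen (BiLat `|` F).
  by move=> f Ff; apply: sub_gen_smallest; right.
split; apply/seteqP; split=> //.
- move=> f _; apply: (all_in_clone (clone_gen_is_clone _) (genBiLat _)).
    by apply: genF; left.
  by apply: genF; right.
- apply: (@smallest_sub _ _ _ (preserving truth_le)).
    exact: preserving_is_clone.
  move=> f [/BiLat_positive // | ->].
  (* Conflation is an automorphism of the truth order: it only exchanges the incomparable n and
     b. *)
  by apply: preserving_unary; do 2!case.
- move=> f; apply: (positive_in_clone (clone_gen_is_clone _) (genBiLat _)).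
  exact: genF.
- apply: (@smallest_sub _ _ _ (preserving info_le)).
    exact: preserving_is_clone.
  move=> f [/BiLat_persistent // | ->].
  (* Dually, negation only exchanges t and f, incomparable in the information order. *)
  by apply: preserving_unary; do 2!case.
- move=> f; apply: (persistent_in_clone (clone_gen_is_clone _) (genBiLat _)).
  exact: genF.
Qed.
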